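(* Let $(\mathfrak g,[\cdot,\cdot]_{\mathfrak g},[\![\cdot,\cdot,\cdot]\!]_{\mathfrak g})$ and $(\mathfrak h,[\cdot,\cdot]_{\mathfrak h},[\![\cdot,\cdot,\cdot]\!]_{\mathfrak h})$ be two Lie-Yamaguti algebras, and let $H:\mathfrak g\to\mathfrak h$ be a crossed homomorphism with respect to an action $(\rho,\mu)$ of $\mathfrak g$ on $\mathfrak h$. Define $\rho_H:\mathfrak g\to\mathfrak{gl}(\mathfrak h)$, $\mu_H:\otimes^2\mathfrak g\to\mathfrak{gl}(\mathfrak h)$ and $D_H:\wedge^2\mathfrak g\to\mathfrak{gl}(\mathfrak h)$ by $$\rho_H(x)u:=[Hx,u]_{\mathfrak h}+\rho(x)u,\qquad \mu_H(x,y)u:=[\![u,Hx,Hy]\!]_{\mathfrak h}+\mu(x,y)u,\qquad D_H(x,y)u:=[\![Hx,Hy,u]\!]_{\mathfrak h}+D(x,y)u$$ for all $x,y\in\mathfrak g$, $u\in\mathfrak h$. Then $(\mathfrak h;\rho_H,\mu_H)$ (with $D_{\rho_H,\mu_H}$ given by $D_H$) is a representation of $\mathfrak g$ on the vector space $\mathfrak h$.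
   Context: All vector spaces are finite-dimensional over a field $\mathbb K$ of characteristic $0$. A Lie-Yamaguti algebra is a vector space $\mathfrak g$ with a bilinear bracket $[\cdot,\cdot]:\wedge^2\mathfrak g\to\mathfrak g$ and a trilinear bracket $[\![\cdot,\cdot,\cdot]\!]:\wedge^2\mathfrak g\otimes\mathfrak g\to\mathfrak g$ (skew-symmetric in the first two arguments) such that for all $x,y,z,w,t\in\mathfrak g$: (1) $[[x,y],z]+[[y,z],x]+[[z,x],y]+[\![x,y,z]\!]+[\![y,z,x]\!]+[\![z,x,y]\!]=0$; (2) $[\![[x,y],z,w]\!]+[\![[y,z],x,w]\!]+[\![[z,x],y,w]\!]=0$; (3) $[\![x,y,[z,w]]\!]=[[\![x,y,z]\!],w]+[z,[\![x,y,w]\!]]$; (4) $[\![x,y,[\![z,w,t]\!]]\!]=[\![[\![x,y,z]\!],w,t]\!]+[\![z,[\![x,y,w]\!],t]\!]+[\![z,w,[\![x,y,t]\!]]\!]$. A representation of $\mathfrak g$ on a vector space $V$ is a linear map $\rho:\mathfrak g\to\mathfrak{gl}(V)$ and a bilinear map $\mu:\otimes^2\mathfrak g\to\mathfrak{gl}(V)$ such that, with $D(x,y)=D_{\rho,\mu}(x,y):=\mu(y,x)-\mu(x,y)+[\rho(x),\rho(y)]-\rho([x,y])$, for all $x,y,z,w\in\mathfrak g$: $\mu([x,y],z)-\mu(x,z)\rho(y)+\mu(y,z)\rho(x)=0$; $\mu(x,[y,z])-\rho(y)\mu(x,z)+\rho(z)\mu(x,y)=0$; $\rho([\![x,y,z]\!])=[D(x,y),\rho(z)]$;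 $\mu(z,w)\mu(x,y)-\mu(y,w)\mu(x,z)-\mu(x,[\![y,z,w]\!])+D(y,z)\mu(x,w)=0$; $\mu([\![x,y,z]\!],w)+\mu(z,[\![x,y,w]\!])=[D(x,y),\mu(z,w)]$. The center of $\mathfrak h$ is $C(\mathfrak h):=\{u:[u,v]=0\ \forall v\}\cap\big(\{u:[\![u,v,w]\!]=0\ \forall v,w\}\cup\{u:[\![v,u,w]\!]=0\ \forall v,w\}\big)$. An action of $\mathfrak g$ on $\mathfrak h$ is a representation $(\rho,\mu)$ of $\mathfrak g$ on the vector space $\mathfrak h$ such that for all $x,y\in\mathfrak g$, $u,v,w\in\mathfrak h$: $\rho(x)u,\ \mu(x,y)u\in C(\mathfrak h)$; $\rho(x)[u,v]_{\mathfrak h}=\mu(x,y)[u,v]_{\mathfrak h}=0$; $\rho(x)[\![u,v,w]\!]_{\mathfrak h}=\mu(x,y)[\![u,v,w]\!]_{\mathfrak h}=0$. A crossed homomorphism from $\mathfrak g$ to $\mathfrak h$ with respect to an action $(\rho,\mu)$ is a linear map $H:\mathfrak g\to\mathfrak h$ such that for all $x,y,z\in\mathfrak g$: $H[x,y]_{\mathfrak g}=\rho(x)H(y)-\rho(y)H(x)+[Hx,Hy]_{\mathfrak h}$ and $H[\![x,y,z]\!]_{\mathfrak g}=D(x,y)H(z)+\mu(y,z)H(x)-\mu(x,z)H(y)+[\![Hx,Hy,Hz]\!]_{\mathfrak h}$. *)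

(* Defs.v *)
From HB Require Import structures.
From mathcomp Require Import all_boot all_order all_algebra.

Set Implicit Arguments.
Unset Strict Implicit.
Unset Printing Implicit Defensive.

Import GRing.Theory.
Local Open Scope ring_scope.

Reserved Notation "{[ x , y ]}" (at level 0, x, y at level 99,
  format "{[ x ,  y ]}").
Reserved Notation "{[ x , y , z ]}" (at level 0, x, y, z at level 99,
  format "{[ x ,  y ,  z ]}").

(* Maps on the exterior square of g are encoded as alternating maps in their   *)
(* first two arguments, which is skew-symmetry in characteristic 0.            *)
HB.mixin Record isLieYamaguti (K : fieldType) g of Vector K g := {
  lybr : g -> g -> g;
  lytr : g -> g -> g -> g;
  lybr_linear_l : forall y, linear (fun x => lybr x y);
  lybr_linear_r : forall x, linear (fun y => lybr x y);
  lybr_alt : forall x, lybr x x = 0;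
  lytr_linear_1 : forall y z, linear (fun x => lytr x y z);
  lytr_linear_2 : forall x z, linear (fun y => lytr x y z);
  lytr_linear_3 : forall x y, linear (fun z => lytr x y z);
  lytr_alt : forall x z, lytr x x z = 0;
  lybr_jacobi : forall x y z,
    lybr (lybr x y) z + lybr (lybr y z) x + lybr (lybr z x) y
    + lytr x y z + lytr y z x + lytr z x y = 0;
  lytr_cyclic : forall x y z w,
    lytr (lybr x y) z w + lytr (lybr y z) x w + lytr (lybr z x) y w = 0;
  lytr_lybr : forall x y z w,
    lytr x y (lybr z w) = lybr (lytr x y z) w + lybr z (lytr x y w);
  lytr_lytr : forall x y z w t,
    lytr x y (lytr z w t)
    = lytr (lytr x y z) w t + lytr z (lytr x y w) t + lytr z w (lytr x y t)
}.

#[short(type="lieYamagutiType")]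
HB.structure Definition LieYamaguti (K : fieldType) :=
  {g of isLieYamaguti K g & Vector K g}.

Notation "{[ x , y ]}" := (lybr x y) : ring_scope.
Notation "{[ x , y , z ]}" := (lytr x y z) : ring_scope.

Definition glbr (K : fieldType) (V : vectType K) (a b : 'End(V)) : 'End(V) :=
  (a \o b)%VF - (b \o a)%VF.

Section Representation.

Variables (K : fieldType) (g : lieYamagutiType K) (V : vectType K).
Variables (rho : g -> 'End(V)) (mu : g -> g -> 'End(V)).

Definition repD (x y : g) : 'End(V) :=
  mu y x - mu x y + glbr (rho x) (rho y) - rho {[x, y]}.

Record is_representation : Prop := IsRepresentation {
  rep_rho_linear : linear rho;
  rep_mu_linear_l : forall y, linear (fun x => mu x y);
  rep_mu_linear_r : forall x, linear (fun y => mu x y);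
  rep_mu_lybr_l : forall x y z,
    mu {[x, y]} z - (mu x z \o rho y)%VF + (mu y z \o rho x)%VF = 0;
  rep_mu_lybr_r : forall x y z,
    mu x {[y, z]} - (rho y \o mu x z)%VF + (rho z \o mu x y)%VF = 0;
  rep_rho_lytr : forall x y z,
    rho {[x, y, z]} = glbr (repD x y) (rho z);
  rep_mu_lytr : forall x y z w,
    (mu z w \o mu x y)%VF - (mu y w \o mu x z)%VF
    - mu x {[y, z, w]} + (repD y z \o mu x w)%VF = 0;
  rep_mu_repD : forall x y z w,
    mu {[x, y, z]} w + mu z {[x, y, w]} = glbr (repD x y) (mu z w)
}.

End Representation.

Definition in_center (K : fieldType) (h : lieYamagutiType K) (u : h) : Prop :=
  (forall v, {[u, v]} = 0) /\
  ((forall v w, {[u, v, w]} = 0) \/ (forall v w, {[v, u, w]} = 0)).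

Section CrossedHom.

Variables (K : fieldType) (g h : lieYamagutiType K).
Variables (rho : g -> 'End(h)) (mu : g -> g -> 'End(h)).

Record is_action : Prop := IsAction {
  action_rep : is_representation rho mu;
  action_rho_center : forall x u, in_center (rho x u);
  action_mu_center : forall x y u, in_center (mu x y u);
  action_rho_lybr : forall x u v, rho x {[u, v]} = 0;
  action_mu_lybr : forall x y u v, mu x y {[u, v]} = 0;
  action_rho_lytr : forall x u v w, rho x {[u, v, w]} = 0;
  action_mu_lytr : forall x y u v w, mu x y {[u, v, w]} = 0
}.

Record is_crossed_hom (H : 'Hom(g, h)) : Prop := IsCrossedHom {
  crossed_lybr : forall x y,
    H {[x, y]} = rho x (H y) - rho y (H x) + {[H x, H y]};
  crossed_lytr : forall x y z,
    H {[x, y, z]}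
    = repD rho mu x y (H z) + mu y z (H x) - mu x z (H y)
      + {[H x, H y, H z]}
}.

Variable H : 'Hom(g, h).

(* [linfun f] is only meaningful for linear [f]; the lemmas [rhoHE], [muHE]    *)
(* and [DHE] below show that this is the case here.                            *)
Definition rhoH (x : g) : 'End(h) := linfun (fun u => {[H x, u]} + rho x u).

Definition muH (x y : g) : 'End(h) :=
  linfun (fun u => {[u, H x, H y]} + mu x y u).

Definition DH (x y : g) : 'End(h) :=
  linfun (fun u => {[H x, H y, u]} + repD rho mu x y u).

Lemma linfun_addE (f : h -> h) (a : 'End(h)) (u : h) :
  linear f -> linfun (fun v => f v + a v) u = f u + a u.
Proof.
move=> lin_f.
have lin_fa : linear (fun v => f v + a v).
  by move=> k v w; rewrite lin_f linearP scalerDr addrACA.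
pose B := GRing.isLinear.Build _ _ _ _ _ lin_fa.
pose F : {linear h -> h} := HB.pack (fun v => f v + a v) B.
exact: (lfunE F u).
Qed.

Lemma rhoHE x u : rhoH x u = {[H x, u]} + rho x u.
Proof. exact: linfun_addE (lybr_linear_r _). Qed.

Lemma muHE x y u : muH x y u = {[u, H x, H y]} + mu x y u.
Proof. exact: linfun_addE (lytr_linear_1 _ _). Qed.

Lemma DHE x y u : DH x y u = {[H x, H y, u]} + repD rho mu x y u.
Proof. exact: linfun_addE (lytr_linear_3 _ _). Qed.

End CrossedHom.

(* Main.v *)
Require Import Defs.
From mathcomp Require Import all_boot all_order all_algebra.

(** The twisted maps are the sum of two representations that do not see each
    other.  On the one hand [h] acts on itself by the adjoint representation
    [u |-> {[a, u]}], [u |-> {[u, a, b]}], whose associated [repD] is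
    [u |-> {[a, b, u]}] (lemmas [adjoint_*]); composing it with [H] gives the
    bracket parts of [rhoH], [muH] and [DH].  On the other hand there is the
    given representation [(rho, mu)].

    Two facts make the sum a representation, although the identities to verify
    are quadratic and [H] is not a homomorphism.  First, the values of [rho],
    [mu] and [repD rho mu] are maps into the center that vanish on brackets, so
    in a composite of two twisted maps both mixed terms vanish
    ([twisted_comp]).  Second, the terms by which [H] fails to be a
    homomorphism lie in the images of these maps, hence in the center
    ([crossed_lybr_center], [crossed_lytr_center]); and brackets do not change
    when an argument changes by a central element.  So [H] behaves as a
    homomorphism inside the brackets, and each identity is the sum of the one
    for the adjoint representation at the values of [H] and the one for
    [(rho, mu)]. *)

Set Implicit Arguments.
Unset Strict Implicit.
Unset Printing Implicit Defensive.

Import GRing.Theory.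
Local Open Scope ring_scope.

(** * Skew-symmetry of the brackets *)

Lemma linear_funD (K : fieldType) (V W : lmodType K) (f : V -> W) :
  linear f -> {morph f : u v / u + v}.
Proof. by move=> lin_f u v; have := lin_f 1 u v; rewrite !scale1r. Qed.

Lemma linear_fun0 (K : fieldType) (V W : lmodType K) (f : V -> W) :
  linear f -> f 0 = 0.
Proof.
by move=> lin_f; apply: (addrI (f 0)); rewrite -(linear_funD lin_f) !addr0.
Qed.

Lemma linear_funN (K : fieldType) (V W : lmodType K) (f : V -> W) :
  linear f -> {morph f : u / - u}.
Proof.
move=> lin_f u; apply/eqP.
by rewrite -addr_eq0 -(linear_funD lin_f) addNr linear_fun0.
Qed.

Lemma alternating_skew (U V : zmodType) (f : U -> U -> V) :
    (forall z, {morph f^~ z : x y / x + y}) ->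
    (forall x, {morph f x : y z / y + z}) ->
    (forall x, f x x = 0) ->
  forall x y, f x y = - f y x.
Proof.
move=> fDl fDr f_alt x y; apply/eqP; rewrite -addr_eq0.
by have := f_alt (x + y); rewrite fDl !fDr !f_alt add0r addr0 => ->.
Qed.

Section Brackets.

Variables (K : fieldType) (h : lieYamagutiType K).
Implicit Types a b c d u v w : h.

Lemma lybr_skew a b : {[a, b]} = - {[b, a]}.
Proof.
apply: (alternating_skew (f := fun x y => {[x, y]})) => [z|x|x].
- exact: linear_funD (lybr_linear_l z).
- exact: linear_funD (lybr_linear_r x).
- exact: lybr_alt.
Qed.

Lemma lytr_skew a b c : {[a, b, c]} = - {[b, a, c]}.
Proof.
apply: (alternating_skew (f := fun x y => {[x, y, c]})) => [z|x|x].
- exact: linear_funD (lytr_linear_1 z c).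
- exact: linear_funD (lytr_linear_2 x c).
- exact: lytr_alt.
Qed.

(** * The adjoint representation *)

(** This is [lybr_jacobi] solved for its term [{[a, b, u]}].  The left-hand
    side is the value at [u] of the [repD] of the adjoint representation. *)
Lemma adjoint_repD a b u :
  {[u, b, a]} - {[u, a, b]} + ({[a, {[b, u]}]} - {[b, {[a, u]}]})
  - {[{[a, b]}, u]} = {[a, b, u]}.
Proof.
rewrite [{[u, b, a]}]lytr_skew [{[a, {[b, u]}]}]lybr_skew.
rewrite [{[b, {[a, u]}]}]lybr_skew [{[a, u]}]lybr_skew.
rewrite (linear_funN (lybr_linear_l b)) opprK -!opprD.
apply/esym/eqP; rewrite -addr_eq0 -(lybr_jacobi a b u); apply/eqP.
by rewrite [LHS](AC (1*(2*2*1)) (6*4*5*1*2*3)).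
Qed.

Lemma adjoint_mu_lybr_l a b c u :
  {[u, {[a, b]}, c]} - {[{[b, u]}, a, c]} + {[{[a, u]}, b, c]} = 0.
Proof.
rewrite [{[u, {[a, b]}, c]}]lytr_skew [{[a, u]}]lybr_skew.
by rewrite (linear_funN (lytr_linear_1 b c)) -!opprD lytr_cyclic oppr0.
Qed.

Lemma adjoint_mu_lybr_r a b c u :
  {[u, a, {[b, c]}]} - {[b, {[u, a, c]}]} + {[c, {[u, a, b]}]} = 0.
Proof. by rewrite lytr_lybr addrK [{[c, _]}]lybr_skew subrr. Qed.

Lemma adjoint_rho_lytr a b c u :
  {[{[a, b, c]}, u]} = {[a, b, {[c, u]}]} - {[c, {[a, b, u]}]}.
Proof. by rewrite lytr_lybr addrK. Qed.

Lemma lytr_commutator a b c d u :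
  {[a, b, {[c, d, u]}]} - {[c, d, {[a, b, u]}]}
  = {[{[a, b, c]}, d, u]} + {[c, {[a, b, d]}, u]}.
Proof. by rewrite lytr_lytr addrK. Qed.

(** The last two terms are the commutator of the derivations [{[b, c, _]}] and
    [{[u, a, _]}] at [d].  Computed with the two derivations exchanged, the
    same commutator is the opposite of the first two terms. *)
Lemma adjoint_mu_lytr a b c d u :
  {[{[u, a, b]}, c, d]} - {[{[u, a, c]}, b, d]} - {[u, a, {[b, c, d]}]}
  + {[b, c, {[u, a, d]}]} = 0.
Proof.
rewrite -addrA [- _ + _]addrC -[X in _ + X]opprB lytr_commutator.
by rewrite [{[b, {[u, a, c]}, d]}]lytr_skew subrr.
Qed.

Lemma adjoint_mu_repD a b c d u :
  {[u, {[a, b, c]}, d]} + {[u, c, {[a, b, d]}]}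
  = {[a, b, {[u, c, d]}]} - {[{[a, b, u]}, c, d]}.
Proof. by rewrite (lytr_lytr a b) -2!addrA [RHS]addrC !addrA subrK. Qed.

(** * The center *)

Section Central.

Variable c : h.
Hypothesis c_central : in_center c.

Lemma central_lybr_l u : {[c, u]} = 0.
Proof. by case: c_central. Qed.

Lemma central_lybr_r u : {[u, c]} = 0.
Proof. by rewrite lybr_skew central_lybr_l oppr0. Qed.

Lemma central_lytr_1 u v : {[c, u, v]} = 0.
Proof. by case: c_central => _ [c0|c0]; rewrite ?c0 // lytr_skew c0 oppr0. Qed.

Lemma central_lytr_2 u v : {[u, c, v]} = 0.
Proof. by rewrite lytr_skew central_lytr_1 oppr0. Qed.

(** The definition of the center constrains the first two arguments of the
    ternary bracket; [lybr_jacobi], in the form [adjoint_repD], carries this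
    over to the third one. *)
Lemma central_lytr_3 u v : {[u, v, c]} = 0.
Proof.
rewrite -adjoint_repD !central_lytr_1 !central_lybr_r.
by rewrite !(linear_fun0 (lybr_linear_r _)) !(subrr, addr0).
Qed.

End Central.

Lemma in_centerD a b : in_center a -> in_center b -> in_center (a + b).
Proof.
move=> a_central b_central; split=> [v|].
  by rewrite (linear_funD (lybr_linear_l v)) !central_lybr_l ?addr0.
left=> v w.
by rewrite (linear_funD (lytr_linear_1 v w)) !central_lytr_1 ?addr0.
Qed.

Lemma in_centerN a : in_center a -> in_center (- a).
Proof.
move=> a_central; split=> [v|].
  by rewrite (linear_funN (lybr_linear_l v)) central_lybr_l ?oppr0.
by left=> v w; rewrite (linear_funN (lytr_linear_1 v w)) central_lytr_1 ?oppr0.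
Qed.

(** The bracket parts of [rhoH], [muH] and [DH] are of these three forms;
    a common predicate lets one lemma treat all their composites. *)
Variant adjoint_map : (h -> h) -> Prop :=
| AdjointRho a : adjoint_map (fun u => {[a, u]})
| AdjointMu a b : adjoint_map (fun u => {[u, a, b]})
| AdjointD a b : adjoint_map (fun u => {[a, b, u]}).

Lemma adjoint_mapD f : adjoint_map f -> {morph f : u v / u + v}.
Proof.
case=> [a|a b|a b].
- exact: linear_funD (lybr_linear_r a).
- exact: linear_funD (lytr_linear_1 a b).
- exact: linear_funD (lytr_linear_3 a b).
Qed.

Lemma adjoint_map_central f c : adjoint_map f -> in_center c -> f c = 0.
Proof.
move=> f_adj c_central; case: f_adj => [a|a b|a b].
- exact: central_lybr_r.
- exact: central_lytr_1.
- exact: central_lytr_3.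
Qed.

(** What an action requires of each [rho x] and [mu x y], isolated because
    [repD rho mu x y] inherits it ([central_D]). *)
Definition central_map (p : 'End(h)) : Prop :=
  [/\ forall u, in_center (p u),
      forall u v, p {[u, v]} = 0
    & forall u v w, p {[u, v, w]} = 0].

(** The mixed term [f (p' u)] vanishes because [p' u] is central, and
    [p (f' u)] because [f' u] is a bracket. *)
Lemma twisted_comp f f' (p p' : 'End(h)) u :
    adjoint_map f -> adjoint_map f' -> central_map p -> central_map p' ->
  f (f' u + p' u) + p (f' u + p' u) = f (f' u) + p (p' u).
Proof.
move=> f_adj f'_adj [_ p_lybr p_lytr] [p'_central _ _].
rewrite (adjoint_mapD f_adj) (adjoint_map_central f_adj (p'_central u)) addr0.
suff pf' : p (f' u) = 0 by rewrite linearD /= pf' add0r.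
by case: f'_adj.
Qed.

Section ModuloCenter.

Variables a b : h.
Hypothesis ab_central : in_center (a - b).

Lemma eq_lybr_l u : {[a, u]} = {[b, u]}.
Proof.
by rewrite -(subrK b a) (linear_funD (lybr_linear_l u)) central_lybr_l ?add0r.
Qed.

Lemma eq_lytr_2 u v : {[u, a, v]} = {[u, b, v]}.
Proof.
by rewrite -(subrK b a) (linear_funD (lytr_linear_2 u v)) central_lytr_2 ?add0r.
Qed.

Lemma eq_lytr_3 u v : {[u, v, a]} = {[u, v, b]}.
Proof.
by rewrite -(subrK b a) (linear_funD (lytr_linear_3 u v)) central_lytr_3 ?add0r.
Qed.

End ModuloCenter.

End Brackets.

(** * The twisted maps *)

Section Twist.

Variables (K : fieldType) (g h : lieYamagutiType K).
Variables (rho : g -> 'End(h)) (mu : g -> g -> 'End(h)) (H : 'Hom(g, h)).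
Hypotheses (act : is_action rho mu) (crossed : is_crossed_hom rho mu H).

Local Notation D := (repD rho mu).
Local Notation rhoH := (rhoH rho H).
Local Notation muH := (muH mu H).
Local Notation DH := (DH rho mu H).

Lemma central_rho x : central_map (rho x).
Proof.
by split; [apply: action_rho_center act _|apply: action_rho_lybr act _
          |apply: action_rho_lytr act _].
Qed.

Lemma central_mu x y : central_map (mu x y).
Proof.
by split; [apply: action_mu_center act _ _|apply: action_mu_lybr act _ _
          |apply: action_mu_lytr act _ _].
Qed.

Lemma repDE (r : g -> 'End(h)) (m : g -> g -> 'End(h)) x y u :
  repD r m x y u
  = m y x u - m x y u + (r x (r y u) - r y (r x u)) - r {[x, y]} u.
Proof. by rewrite /repD /glbr !lfun_simp. Qed.

Lemma central_D x y : central_map (D x y).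
Proof.
split=> [u|u v|u v w]; rewrite repDE.
- by do ![apply: in_centerD | apply: in_centerN
         | apply: (action_rho_center act) | apply: (action_mu_center act)].
- by rewrite !(action_rho_lybr act) !(action_mu_lybr act) !linear0 !addr0.
- by rewrite !(action_rho_lytr act) !(action_mu_lytr act) !linear0 !addr0.
Qed.

Lemma crossed_lybr_center x y : in_center (H {[x, y]} - {[H x, H y]}).
Proof.
rewrite (crossed_lybr crossed) addrK.
by apply: in_centerD; [|apply: in_centerN]; apply: (action_rho_center act).
Qed.

Lemma crossed_lytr_center x y z :
  in_center (H {[x, y, z]} - {[H x, H y, H z]}).
Proof.
have [D_center _ _] := central_D x y.
rewrite (crossed_lytr crossed) addrK.
by do ![apply: in_centerD | apply: in_centerN | apply: D_center
       | apply: (action_mu_center act)].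
Qed.

(** The bracket part of [rhoH] and [muH] contributes its [repD] by
    [adjoint_repD], and the mixed terms vanish. *)
Lemma repD_twisted x y : repD rhoH muH x y = DH x y.
Proof.
apply/lfunP=> u; rewrite repDE DHE !muHE !rhoHE.
rewrite (twisted_comp _ (AdjointRho (H x)) (AdjointRho (H y))
  (central_rho x) (central_rho y)).
rewrite (twisted_comp _ (AdjointRho (H y)) (AdjointRho (H x))
  (central_rho y) (central_rho x)).
rewrite (eq_lybr_l (crossed_lybr_center x y)).
rewrite -(adjoint_repD (H x) (H y) u) repDE.
rewrite !opprD ![_ + _ + (- _ - _)]addrACA.
by rewrite [LHS]addrACA [X in X + _ = _]addrACA [LHS]addrACA.
Qed.

Lemma rhoH_linear : linear rhoH.
Proof.
have [rho_linear _ _ _ _ _ _ _] := action_rep act.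
move=> k x y; apply/lfunP=> u; rewrite !lfun_simp !rhoHE.
by rewrite linearP rho_linear !lfun_simp (lybr_linear_l u) scalerDr addrACA.
Qed.

Lemma muH_linear_l y : linear (fun x => muH x y).
Proof.
have [_ mu_linear _ _ _ _ _ _] := action_rep act.
move=> k x z; apply/lfunP=> u; rewrite !lfun_simp !muHE.
rewrite linearP (mu_linear y) !lfun_simp (lytr_linear_2 u (H y)).
by rewrite scalerDr addrACA.
Qed.

Lemma muH_linear_r x : linear (fun y => muH x y).
Proof.
have [_ _ mu_linear _ _ _ _ _] := action_rep act.
move=> k y z; apply/lfunP=> u; rewrite !lfun_simp !muHE.
rewrite linearP (mu_linear x) !lfun_simp (lytr_linear_3 u (H x)).
by rewrite scalerDr addrACA.
Qed.

Lemma muH_lybr_l x y z :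
  muH {[x, y]} z - (muH x z \o rhoH y)%VF + (muH y z \o rhoH x)%VF = 0.
Proof.
have [_ _ _ mu_lybr _ _ _ _] := action_rep act.
apply/lfunP=> u; rewrite !lfun_simp !muHE !rhoHE.
rewrite (twisted_comp _ (AdjointMu (H x) (H z)) (AdjointRho (H y))
  (central_mu x z) (central_rho y)).
rewrite (twisted_comp _ (AdjointMu (H y) (H z)) (AdjointRho (H x))
  (central_mu y z) (central_rho x)).
rewrite (eq_lytr_2 (crossed_lybr_center x y)).
rewrite opprD [_ + _ + (- _ - _)]addrACA [LHS]addrACA adjoint_mu_lybr_l add0r.
by have /lfunP/(_ u) := mu_lybr x y z; rewrite !lfun_simp.
Qed.

Lemma muH_lybr_r x y z :
  muH x {[y, z]} - (rhoH y \o muH x z)%VF + (rhoH z \o muH x y)%VF = 0.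
Proof.
have [_ _ _ _ mu_lybr _ _ _] := action_rep act.
apply/lfunP=> u; rewrite !lfun_simp !muHE !rhoHE.
rewrite (twisted_comp _ (AdjointRho (H y)) (AdjointMu (H x) (H z))
  (central_rho y) (central_mu x z)).
rewrite (twisted_comp _ (AdjointRho (H z)) (AdjointMu (H x) (H y))
  (central_rho z) (central_mu x y)).
rewrite (eq_lytr_3 (crossed_lybr_center y z)).
rewrite opprD [_ + _ + (- _ - _)]addrACA [LHS]addrACA adjoint_mu_lybr_r add0r.
by have /lfunP/(_ u) := mu_lybr x y z; rewrite !lfun_simp.
Qed.

Lemma rhoH_lytr x y z : rhoH {[x, y, z]} = glbr (DH x y) (rhoH z).
Proof.
have [_ _ _ _ _ rho_lytr _ _] := action_rep act.
apply/lfunP=> u; rewrite /glbr !lfun_simp !DHE !rhoHE.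
rewrite (twisted_comp _ (AdjointD (H x) (H y)) (AdjointRho (H z))
  (central_D x y) (central_rho z)).
rewrite (twisted_comp _ (AdjointRho (H z)) (AdjointD (H x) (H y))
  (central_rho z) (central_D x y)).
rewrite (eq_lybr_l (crossed_lytr_center x y z)) adjoint_rho_lytr rho_lytr.
by rewrite /glbr !lfun_simp opprD [RHS]addrACA.
Qed.

Lemma muH_lytr x y z w :
  (muH z w \o muH x y)%VF - (muH y w \o muH x z)%VF
  - muH x {[y, z, w]} + (DH y z \o muH x w)%VF = 0.
Proof.
have [_ _ _ _ _ _ mu_lytr _] := action_rep act.
apply/lfunP=> u; rewrite !lfun_simp !DHE !muHE.
rewrite (twisted_comp _ (AdjointMu (H z) (H w)) (AdjointMu (H x) (H y))
  (central_mu z w) (central_mu x y)).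
rewrite (twisted_comp _ (AdjointMu (H y) (H w)) (AdjointMu (H x) (H z))
  (central_mu y w) (central_mu x z)).
rewrite (twisted_comp _ (AdjointD (H y) (H z)) (AdjointMu (H x) (H w))
  (central_D y z) (central_mu x w)).
rewrite (eq_lytr_3 (crossed_lytr_center y z w)) !opprD.
rewrite [X in X + (- _ - _)]addrACA [X in X + _]addrACA [LHS]addrACA.
rewrite adjoint_mu_lytr add0r.
by have /lfunP/(_ u) := mu_lytr x y z w; rewrite !lfun_simp.
Qed.

Lemma muH_repD x y z w :
  muH {[x, y, z]} w + muH z {[x, y, w]} = glbr (DH x y) (muH z w).
Proof.
have [_ _ _ _ _ _ _ mu_repD] := action_rep act.
apply/lfunP=> u; rewrite /glbr !lfun_simp !DHE !muHE.
rewrite (twisted_comp _ (AdjointD (H x) (H y)) (AdjointMu (H z) (H w))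
  (central_D x y) (central_mu z w)).
rewrite (twisted_comp _ (AdjointMu (H z) (H w)) (AdjointD (H x) (H y))
  (central_mu z w) (central_D x y)).
rewrite (eq_lytr_2 (crossed_lytr_center x y z)).
rewrite (eq_lytr_3 (crossed_lytr_center x y w)).
rewrite [LHS]addrACA adjoint_mu_repD opprD [RHS]addrACA; congr (_ + _).
by have /lfunP/(_ u) := mu_repD x y z w; rewrite /glbr !lfun_simp.
Qed.

End Twist.

Unset Implicit Arguments.

Theorem proposition4p2 (K : fieldType) (charK0 : [pchar K] =i pred0)
    (g h : lieYamagutiType K)
    (rho : g -> 'End(h)) (mu : g -> g -> 'End(h)) (H : 'Hom(g, h))
    (act : is_action rho mu) (crossed : is_crossed_hom rho mu H) :
  is_representation (rhoH rho H) (muH mu H) /\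
  (forall x y : g, repD (rhoH rho H) (muH mu H) x y = DH rho mu H x y).
Proof.
split; last exact: repD_twisted act crossed.
split=> *; rewrite ?(repD_twisted act crossed).
- exact: (rhoH_linear H act).
- exact: (muH_linear_l H act).
- exact: (muH_linear_r H act).
- exact: muH_lybr_l act crossed _ _ _.
- exact: muH_lybr_r act crossed _ _ _.
- exact: rhoH_lytr act crossed _ _ _.
- exact: muH_lytr act crossed _ _ _ _.
- exact: muH_repD act crossed _ _ _ _.
Qed.
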